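(* Let $p\in[2,\infty)$ and let $X$ be a $p$-uniformly PL-convex complex Banach space with $\dim X\ge2$. Then for every $n\in\mathbb N$, $$\Big(\frac{I_p(X)}{2^p+I_p(X)}\Big)^{2/p}\le r_p^n(X)\le1.$$
   Context: A complex Banach space $X$ is $p$-uniformly PL-convex ($2\le p<\infty$) if there is $\lambda>0$ with $\|x\|^p+\lambda\|y\|^p\le\frac1{2\pi}\int_0^{2\pi}\|x+e^{i\theta}y\|^p\,d\theta$ for all $x,y\in X$; $I_p(X)$ denotes the supremum of all such $\lambda$. For a holomorphic $f:\mathbb D^n\to X$ ($\mathbb D^n$ the open unit polydisk), $f(z)=x_0+\sum_{|\alpha|\ge1}x_\alpha z^\alpha$ (multi-index notation), with $\sup_{z\in\mathbb D^n}\|f(z)\|\le1$, let $r_p^n(f,X)=\sup\{r\ge0:\|x_0\|^p+\sum_{k\ge1}\sum_{|\alpha|=k}\|x_\alpha z^\alpha\|^p\le1\ \forall z\in r\mathbb D^n\}$ and $r_p^n(X)=\inf$ of $r_p^n(f,X)$ over all such $f$. *)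

(* Defs.v *)
From HB Require Import structures.
From mathcomp Require Import all_boot all_order all_algebra.
From mathcomp Require Import all_classical all_reals all_analysis.
From mathcomp Require Import complex.
Set Implicit Arguments. Unset Strict Implicit. Unset Printing Implicit Defensive.
Import Order.TTheory GRing.Theory Num.Theory.
Import numFieldNormedType.Exports.
Local Open Scope classical_set_scope.
Local Open Scope ring_scope.

Section PL.
Variable R : realType.
Variable X : completeNormedModType R[i].

(* the (real-valued) norm of X; the library norm `|x| lives in R[i] *)
Definition nX (x : X) : R := complex.Re `|x|.

Definition expi (t : R) : R[i] := (cos t +i* sin t)%C.

Definition PL_ineq (p lam : R) : Prop :=
  forall x y : X,
    ((nX x `^ p + lam * nX y `^ p)%:E <=
     ((2 * pi)^-1)%:E *
       \int[@lebesgue_measure R]_(t in `[0%R, (2 * pi)%R]) (nX (x + expi t *: y) `^ p)%:E)%E.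

Definition PL_convex (p : R) : Prop := exists2 lam : R, 0 < lam & PL_ineq p lam.

Definition I_p (p : R) : R := sup [set lam : R | 0 < lam /\ PL_ineq p lam].

Definition dim_ge2 : Prop :=
  exists x y : X, forall a b : R[i], a *: x + b *: y = 0 -> a = 0 /\ b = 0.

Definition mindex (n : nat) := {ffun 'I_n -> nat}.
Definition mzero (n : nat) : mindex n := [ffun => 0%N].
Definition mlift (n N : nat) (a : {ffun 'I_n -> 'I_N}) : mindex n :=
  [ffun i => nat_of_ord (a i)].

Definition zmono (n : nat) (z : 'I_n -> R[i]) (a : mindex n) : R[i] :=
  \prod_(i < n) z i ^+ a i.

Definition in_polydisk (n : nat) (r : R) (z : 'I_n -> R[i]) : Prop :=
  forall i, complex.Re `|z i| < r.

(* coefficient families (x_alpha) of holomorphic f : D^n -> X with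
   sup_{z in D^n} ||f z|| <= 1; f z = sum_alpha x_alpha z^alpha, the series
   converging absolutely on D^n (f z is the limit of the partial sums over
   the boxes {alpha | alpha_i < N}) *)
Definition bounded_holo_coef (n : nat) (c : mindex n -> X) : Prop :=
  (forall z, in_polydisk 1 z ->
     (\esum_(a in [set: mindex n]) (nX (zmono z a *: c a))%:E < +oo)%E) /\
  (forall z, in_polydisk 1 z ->
     exists2 fz : X,
       (fun N : nat => \sum_(a : {ffun 'I_n -> 'I_N}) zmono z (mlift a) *: c (mlift a))
         @ \oo --> fz
     & nX fz <= 1).

Definition p_sum (p : R) (n : nat) (c : mindex n -> X) (z : 'I_n -> R[i]) : \bar R :=
  ((nX (c (mzero n)) `^ p)%:E +
   \esum_(a in [set a : mindex n | a != mzero n]) (nX (zmono z a *: c a) `^ p)%:E)%E.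

Definition r_pf (p : R) (n : nat) (c : mindex n -> X) : \bar R :=
  ereal_sup [set r%:E | r in [set r : R | 0 <= r /\
     forall z, in_polydisk r z -> (p_sum p c z <= 1%:E)%E]].

Definition r_pn (p : R) (n : nat) : \bar R :=
  ereal_inf [set r_pf p c | c in [set c : mindex n -> X | bounded_holo_coef c]].

End PL.

(* Main.v *)
Require Import Defs.
From HB Require Import structures.
From mathcomp Require Import all_boot all_order all_algebra.
From mathcomp Require Import all_classical all_reals all_analysis.
From mathcomp Require Import complex.
From mathcomp Require Import measurable_realfun ring lra zify.
Import Order.TTheory GRing.Theory Num.Theory.
Import numFieldNormedType.Exports.
Local Open Scope ring_scope.
Set Implicit Arguments. Unset Strict Implicit. Unset Printing Implicit Defensive.

(* One variable: let g be an X-valued polynomial with mean value g_0. Convolving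
   with the Fejer-type kernel 1 + cos(k t) >= 0 gives g_0 + e^{it} g_k / 2, so
   Jensen's inequality and p-uniform PL-convexity give
     |g_0|^p + (lam / 2^p) |g_k|^p <= mean of |g|^p over the circle.
   Weighting this by s^k, where s <= (lam / 2^p) (1 - s), and summing over k yields
     sum_k s^k |g_k|^p <= mean of |g|^p.
   This last inequality tensorizes with constant 1, so it holds on the torus in any
   dimension, and the radius s^{1/p} = (lam / (2^p + lam))^{1/p}, which is at least
   the claimed one, does not depend on n. All the circle means are taken over roots
   of unity of order at least twice the degree, where they are exact. The bound
   r <= 1 is attained by f(z) = z_1 u with |u| = 1. *)

(** * Real-valued norms and the points of the unit circle *)

Section ComplexNorm.
Variable R : realType.
Variable X : completeNormedModType R[i].
Implicit Types (x y : X) (a b : R[i]) (t : R).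

Lemma ge0_Re_complex a : 0 <= a -> ((complex.Re a)%:C)%C = a.
Proof. by case: a => u v; rewrite lecE /= => /andP[/eqP -> _]. Qed.

Lemma nXE x : (nX x)%:C%C = `|x|.
Proof. exact: ge0_Re_complex. Qed.

Lemma ReE a : (complex.Re `|a|)%:C%C = `|a|.
Proof. exact: ge0_Re_complex. Qed.

Lemma nX_ge0 x : 0 <= nX x.
Proof. by rewrite -lecR nXE normr_ge0. Qed.

Lemma nX_triangle x y : nX (x + y) <= nX x + nX y.
Proof. by rewrite -lecR rmorphD /= !nXE ler_normD. Qed.

Lemma nX0 : nX (0 : X) = 0.
Proof. by rewrite /nX normr0. Qed.

Lemma nX_sum (I : Type) (s : seq I) (P : pred I) (F : I -> X) :
  nX (\sum_(i <- s | P i) F i) <= \sum_(i <- s | P i) nX (F i).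
Proof.
elim/big_rec2: _ => [|i u v _ le_vu]; first by rewrite nX0.
by apply: le_trans (nX_triangle _ _) _; rewrite lerD2l.
Qed.

Lemma nXZ a x : nX (a *: x) = complex.Re `|a| * nX x.
Proof. by apply: (@complexI R); rewrite rmorphM /= !nXE ReE normrZ. Qed.

Lemma nXN x : nX (- x) = nX x.
Proof. by rewrite /nX normrN. Qed.

Lemma nX_dist x y : `|nX x - nX y| <= nX (x - y).
Proof.
rewrite ler_norml; apply/andP; split; last first.
  by rewrite lerBlDr; apply: le_trans (nX_triangle _ _); rewrite subrK.
rewrite lerNl opprB lerBlDr -(nXN (x - y)) opprB.
by apply: le_trans (nX_triangle _ _); rewrite subrK.
Qed.

Lemma Re_norm_ge0 a : 0 <= complex.Re `|a|.
Proof. by rewrite -lecR ReE normr_ge0. Qed.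

Lemma Re_normM a b :
  complex.Re `|a * b| = complex.Re `|a| * complex.Re `|b|.
Proof. by apply: (@complexI R); rewrite rmorphM /= !ReE normrM. Qed.

Lemma Re_normX a k : complex.Re `|a ^+ k| = complex.Re `|a| ^+ k.
Proof. by apply: (@complexI R); rewrite rmorphXn /= !ReE normrX. Qed.

Lemma Re_norm_prod (I : Type) (s : seq I) (F : I -> R[i]) :
  complex.Re `|\prod_(i <- s) F i| = \prod_(i <- s) complex.Re `|F i|.
Proof.
apply: (@complexI R); rewrite rmorph_prod /= ReE normr_prod.
by apply: eq_bigr => i _; rewrite ReE.
Qed.

Lemma Re_norm_real t : complex.Re `|(t%:C)%C| = `|t|.
Proof. by rewrite normc_def /= expr0n addr0 sqrtr_sqr. Qed.

Lemma Re_norm_complex (u v : R) :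
  complex.Re `|(u +i* v)%C| = Num.sqrt (u ^+ 2 + v ^+ 2).
Proof. by rewrite normc_def. Qed.

Lemma expiD (s t : R) : expi (s + t) = expi s * expi t.
Proof. by rewrite /expi cosD sinD /GRing.mul/= [in X in (_ +i* X)%C]addrC. Qed.

Lemma expi0 : expi (0 : R) = 1.
Proof. by rewrite /expi cos0 sin0. Qed.

Lemma expiMn t k : expi (t *+ k) = expi t ^+ k.
Proof. by elim: k => [|k IH]; rewrite ?expi0 // mulrS expiD IH exprS. Qed.

Lemma norm_expi t : complex.Re `|expi t| = 1.
Proof. by rewrite Re_norm_complex cos2Dsin2 sqrtr1. Qed.

Lemma expi_neq0 t : expi t != 0.
Proof.
by apply: contraTneq (oner_neq0 R) => e0; rewrite -(norm_expi t) e0 normr0 eqxx.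
Qed.

Lemma expi_2pi : expi (pi *+ 2 : R) = 1.
Proof. by rewrite /expi cos2pi -[pi *+ 2]add0r sinD2pi sin0. Qed.

(** By the half-angle formula, [cos t = 1] would force [sin (t / 2) = 0], but [t / 2] lies strictly
    between 0 and [pi]. *)
Lemma expi_neq1 t : 0 < t < pi *+ 2 -> expi t != 1.
Proof.
move=> /andP[t0 t2]; apply/eqP => /(congr1 (@complex.Re R)) /= H.
have : cos ((t / 2) *+ 2) = 1 by rewrite -mulr_natr divfK.
rewrite cos_mulr2n => H2.
have s0 : 0 < sin (t / 2).
  by apply: sin_gt0_pi; rewrite divr_gt0 //= ltr_pdivrMr // mulr_natr.
have := cos2Dsin2 (t / 2).
have : 0 < sin (t / 2) ^+ 2 by rewrite exprn_gt0.
by move: H2; rewrite -mulr_natr; lra.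
Qed.

End ComplexNorm.

(** * Character sums over the roots of unity of order [N] *)

Section RootsOfUnity.
Variables (R : realType) (N : nat).
Hypothesis N0 : (0 < N)%N.
Let w : R[i] := expi ((pi *+ 2) / N%:R).

Lemma expi_root_order : w ^+ N = 1.
Proof.
by rewrite -expiMn -[X in expi X]mulr_natr divfK ?expi_2pi // pnatr_eq0 -lt0n.
Qed.

Lemma expi_rootX_neq1 l : (0 < l < N)%N -> w ^+ l != 1.
Proof.
move=> /andP[l0 lN]; rewrite -expiMn; apply: expi_neq1.
have p0 : 0 < pi *+ 2 :> R by rewrite pmulrn_rgt0 ?pi_gt0.
have NR : 0 < N%:R :> R by rewrite ltr0n.
rewrite -[_ *+ l]mulr_natr mulr_gt0 ?divr_gt0 ?ltr0n //=.
by rewrite mulrAC ltr_pdivrMr // ltr_pM2l // ltr_nat.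
Qed.

(** A geometric sum of ratio [w ^+ l]: its product with [w ^+ l - 1] is [w ^+ (l * N) - 1 = 0], and
    that factor is nonzero. *)
Lemma sum_expi_root l : (0 < l < N)%N -> \sum_(j < N) w ^+ (j * l) = 0.
Proof.
move=> lN; have := subrX1 (w ^+ l) N.
rewrite -exprM mulnC exprM expi_root_order expr1n subrr => /esym/eqP.
rewrite mulf_eq0 subr_eq0 (negPf (expi_rootX_neq1 lN)) /= => /eqP H.
by rewrite -[RHS]H; apply: eq_bigr => j _; rewrite mulnC exprM.
Qed.

Lemma sum_expi_root_multiple q : \sum_(j < N) w ^+ (j * (q * N)) = N%:R.
Proof.
rewrite (eq_bigr (fun=> 1)); last first.
  by move=> j _; rewrite mulnA mulnC exprM expi_root_order expr1n.
by rewrite sumr_const card_ord.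
Qed.

End RootsOfUnity.

(** * Finite Jensen inequality for real powers *)

Section Jensen.
Variable R : realType.

(** This is Young's inequality for [a * 1] with conjugate exponents [p] and [p / (p - 1)],
    multiplied by [p]. *)
Lemma powR_Bernoulli (p a : R) : 1 < p -> 0 <= a -> 1 + p * (a - 1) <= a `^ p.
Proof.
move=> p1 a0; have p0 : 0 < p by lra.
have pn0 : p != 0 by rewrite gt_eqF.
have p1n0 : p - 1 != 0 by rewrite gt_eqF // subr_gt0.
have q0 : 0 < p / (p - 1) by rewrite divr_gt0 // subr_gt0.
have := conjugate_powR a0 ler01 p0 q0.
rewrite powR1 mulr1 invf_div => H.
have {}H : a <= a `^ p / p + 1 * ((p - 1) / p).
  by apply: H; field.
move: H; rewrite mul1r -mulrDl ler_pdivlMr //; lra.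
Qed.

(** The tangent line at the mean [m] lies below the power: apply Bernoulli to each [a i / m]; the
    linear terms average to zero. *)
Lemma powR_jensen (p : R) (I : finType) (w a : I -> R) :
  1 < p -> (forall i, 0 <= w i) -> \sum_i w i = 1 -> (forall i, 0 <= a i) ->
  (\sum_i w i * a i) `^ p <= \sum_i w i * a i `^ p.
Proof.
move=> p1 w0 w1 a0; set m := \sum_i w i * a i.
have m0 : 0 <= m by apply: sumr_ge0 => i _; rewrite mulr_ge0.
have [->|mn0] := eqVneq m 0.
  rewrite powR0; last by lra.
  by apply: sumr_ge0 => i _; rewrite mulr_ge0 ?powR_ge0.
have mp : 0 < m by rewrite lt_neqAle eq_sym mn0.
have H : 1 <= \sum_i w i * (a i / m) `^ p.
  have E : \sum_i w i * (1 + p * (a i / m - 1)) = 1.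
    transitivity ((1 - p) * \sum_i w i + p / m * m); last first.
      by rewrite w1 divfK //; ring.
    rewrite {2}/m !mulr_sumr -big_split /=.
    by apply: eq_bigr => i _; ring.
  rewrite -[leLHS]E; apply: ler_sum => i _.
  by rewrite ler_wpM2l // powR_Bernoulli // divr_ge0.
have -> : \sum_i w i * a i `^ p = m `^ p * \sum_i w i * (a i / m) `^ p.
  rewrite mulr_sumr; apply: eq_bigr => i _.
  by rewrite mulrCA -powRM ?divr_ge0 // [m * _]mulrC divfK.
by rewrite ler_peMr ?powR_ge0.
Qed.
End Jensen.

(** * Exploiting the PL-convexity integral through trigonometric majorants *)

Section PLIntegral.
Variable R : realType.
Variable X : completeNormedModType R[i].

Lemma continuous_trig_poly (al be ga : R) :
  continuous (fun t : R => al + be * cos t + ga * sin t).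
Proof.
move=> t; apply: cvgD; first apply: cvgD.
- exact: cvg_cst.
- by apply: cvgM; [exact: cvg_cst|exact: continuous_cos].
- by apply: cvgM; [exact: cvg_cst|exact: continuous_sin].
Qed.

Lemma integral_trig_poly (al be ga : R) :
  (\int[@lebesgue_measure R]_(t in `[0%R, (2 * pi)%R])
     (al + be * cos t + ga * sin t)%:E = (2 * pi * al)%:E)%E.
Proof.
pose F (t : R) : R := al * t + be * sin t - ga * cos t.
have dF (t : R) : is_derive t 1 F (al + be * cos t + ga * sin t).
  rewrite /F; apply: is_derive_eq; rewrite /GRing.scale /=; ring.
have cF : continuous F.
  by move=> t; apply/differentiable_continuous/derivable1_diffP; have [] := dF t.
rewrite (@continuous_FTC2 _ _ F).
- rewrite /F -EFinB [2 * pi]mulr_natl cos2pi -[pi *+ 2]add0r sinD2pi.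
  by rewrite sin0 cos0 add0r; congr EFin; ring.
- by rewrite mulr_gt0 ?pi_gt0.
- exact/continuous_subspaceT/continuous_trig_poly.
- split; first by move=> t _; have [] := dF t.
  + exact: cvg_at_right_filter (cF _).
  + exact: cvg_at_left_filter (cF _).
- by move=> t _; rewrite derive1E; have [_ ->] := dF t.
Qed.

(** Serves to make the integrand of [PL_ineq] measurable, so that the integral is monotone. *)
Lemma continuous_nX_expi (x y : X) : continuous (fun t : R => nX (x + expi t *: y)).
Proof.
move=> t; pose g (s : R) := (`|cos t - cos s| + `|sin t - sin s|) * nX y.
have cg : (g s @[s --> t] --> 0)%classic.
  have -> : 0 = (`|cos t - cos t| + `|sin t - sin t|) * nX y.
    by rewrite !subrr normr0 addr0 mul0r.
  apply: cvgM; last exact: cvg_cst.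
  by apply: cvgD; apply: cvg_norm; apply: cvgB;
    [exact: cvg_cst|exact: continuous_cos|exact: cvg_cst|exact: continuous_sin].
apply/cvgrPdist_lt => e e0.
move/cvgrPdist_lt : cg => /(_ e e0); apply: filterS => s.
rewrite sub0r normrN; apply: le_lt_trans.
rewrite (le_trans _ (ler_norm _)) //.
apply: le_trans (nX_dist _ _) _.
rewrite opprD addrACA subrr add0r -scalerBl nXZ ler_wpM2r ?nX_ge0 //.
rewrite Re_norm_complex -[leRHS]ger0_norm ?addr_ge0 // -sqrtr_sqr.
apply: ler_wsqrtr; rewrite [leRHS]sqrrD !real_normK ?num_real //.
by rewrite [leRHS]addrAC lerDl mulrn_wge0 // mulr_ge0.
Qed.

(** The circle mean of a trigonometric polynomial of degree one is its constant term [al]. Integrals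
    occur only here; from now on a pointwise majorant suffices. *)
Lemma PL_ineq_trig_bound (p lam : R) (x y : X) (al be ga : R) :
  PL_ineq X p lam ->
  (forall t, nX (x + expi t *: y) `^ p <= al + be * cos t + ga * sin t) ->
  nX x `^ p + lam * nX y `^ p <= al.
Proof.
move=> /(_ x y) PL H.
rewrite -lee_fin; apply: le_trans PL _.
have pi0 := pi_gt0 R.
have -> : al%:E = ((2 * pi)^-1%:E * (2 * pi * al)%:E)%E.
  by rewrite -EFinM mulKf // gt_eqF // mulr_gt0.
rewrite lee_pmul2l //; last by rewrite lte_fin invr_gt0 mulr_gt0.
rewrite -(integral_trig_poly al be ga); apply: ge0_le_integral => //=.
- by move=> t _; rewrite lee_fin powR_ge0.
- apply/measurable_EFinP; apply: measurable_funTS.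
  have mf := continuous_measurable_fun (@continuous_nX_expi x y).
  exact: (measurableT_comp (measurable_powR p) mf).
- apply/measurable_EFinP; apply: measurable_funTS.
  exact: (continuous_measurable_fun (@continuous_trig_poly al be ga)).
- by move=> t _; rewrite lee_fin.
Qed.

End PLIntegral.

(** * One coefficient against the discrete circle mean *)

Section OneVariable.
Variables (R : realType) (X : completeNormedModType R[i]) (p lam : R).
Hypothesis p1 : 1 < p.
Hypothesis PL : PL_ineq X p lam.
Variables m N : nat.
Hypothesis leq_2m_N : (m.*2 <= N)%N.
Let w : R[i] := expi ((pi *+ 2) / N%:R).

Lemma norm_expi_root l : complex.Re (w ^+ l) ^+ 2 + complex.Im (w ^+ l) ^+ 2 = 1.
Proof. by rewrite -expiMn /= cos2Dsin2. Qed.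

Lemma coef_bound (g : 'I_m -> X) (k0 k : 'I_m) : k0 = 0%N :> nat -> (0 < k)%N ->
  nX (g k0) `^ p + lam / 2 `^ p * nX (g k) `^ p <=
  N%:R^-1 * \sum_(j < N) nX (\sum_(l < m) w ^+ (j * l) *: g l) `^ p.
Proof.
move=> k00 kpos.
have km := ltn_ord k.
have N0 : (0 < N)%N by lia.
have NR0 : N%:R != 0 :> R by rewrite pnatr_eq0 -lt0n.
have NC0 : N%:R != 0 :> R[i] by rewrite pnatr_eq0 -lt0n.
have p0 : 0 <= p by rewrite ltW // (lt_trans ltr01).
have kN : (0 < k < N)%N by lia.
pose C j := complex.Re (w ^+ (j * k)); pose S j := complex.Im (w ^+ (j * k)).
(* The kernel [(1 + cos (t - 2 pi j k / N)) / N], expanded so that its dependence on [t] is visibly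
   of degree one. *)
pose W (t : R) (j : nat) : R := N%:R^-1 * (1 + (cos t * C j + sin t * S j)).
have sumC : \sum_(j < N) C j = 0.
  by have /(congr1 (@complex.Re R)) := sum_expi_root R N0 kN; rewrite raddf_sum.
have sumS : \sum_(j < N) S j = 0.
  by have /(congr1 (@complex.Im R)) := sum_expi_root R N0 kN; rewrite raddf_sum.
pose G (j : nat) := \sum_(l < m) w ^+ (j * l) *: g l.
(* Exponential form of the kernel. The frequency [-k] is written [N - k], so that all exponents are
   natural numbers. *)
have WE t j : (W t j)%:C%C = N%:R^-1 *
   (1 + 2^-1 * (expi t * w ^+ (j * (N - k)) + expi (- t) * w ^+ (j * k))).
  have wkE : w ^+ (j * k) = (C j +i* S j)%C by rewrite /C /S; case: (w ^+ _).
  have wV : w ^+ (j * (N - k)) = (C j -i* S j)%C.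
    have wu : w ^+ (j * k) != 0 by rewrite expf_neq0 // expi_neq0.
    apply: (mulIf wu); rewrite -exprD -mulnDr subnK 1?ltnW //; last by case/andP: kN.
    rewrite mulnC exprM expi_root_order // expr1n wkE.
    have := norm_expi_root (j * k); rewrite -/(C j) -/(S j) => H.
    by apply/eqP; rewrite eq_complex /=; apply/andP; split; apply/eqP; lra.
  have -> : expi t * w ^+ (j * (N - k)) + expi (- t) * w ^+ (j * k) =
            (2 * (cos t * C j + sin t * S j))%:C%C.
    rewrite wV wkE /expi cosN sinN.
    by apply/eqP; rewrite eq_complex /=; apply/andP; split; apply/eqP; ring.
  rewrite /W [in RHS]rmorphM rmorph_nat mulKf ?pnatr_eq0 //.
  by rewrite rmorphM fmorphV rmorph_nat rmorphD rmorph1.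
(* the discrete kernel [W t] multiplies the frequencies 0 and k by 1 and e^{it} / 2; it also
   sees the frequency -k, i.e. N - k, which [g] does not have since N >= 2 m *)
have GW t : g k0 + expi t *: (2^-1 *: g k) = \sum_(j < N) (W t j)%:C%C *: G j.
  have coef (l : 'I_m) : \sum_(j < N) (W t j)%:C%C * w ^+ (j * l) =
      (l == k0)%:R + expi t * 2^-1 * (l == k)%:R.
    have -> : \sum_(j < N) (W t j)%:C%C * w ^+ (j * l) = N%:R^-1 *
        (\sum_(j < N) w ^+ (j * l) + 2^-1 * (expi t * \sum_(j < N) w ^+ (j * (N - k + l))
           + expi (- t) * \sum_(j < N) w ^+ (j * (k + l)))).
      rewrite !mulr_sumr -big_split /= !mulr_sumr -big_split /= mulr_sumr.
      by apply: eq_bigr => j _; rewrite WE !mulnDr !exprD; ring.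
    have klN : (0 < k + l < N)%N.
      by have := ltn_ord l; lia.
    rewrite (sum_expi_root R N0 klN) mulr0 addr0.
    have -> : \sum_(j < N) w ^+ (j * l) = (l == k0)%:R * N%:R.
      have [->|lk] := eqVneq l k0.
        by rewrite k00 -(mul0n N) sum_expi_root_multiple // mul1r.
      have {}lk : l != k0 :> nat by rewrite (inj_eq val_inj).
      by rewrite sum_expi_root ?mul0r //; have := ltn_ord l; lia.
    have -> : \sum_(j < N) w ^+ (j * (N - k + l)) = (l == k)%:R * N%:R.
      have lm := ltn_ord l; have [->|lk] := eqVneq l k.
        rewrite mul1r -[RHS](sum_expi_root_multiple R N0 1).
        by apply: eq_bigr => j _; congr (_ ^+ (_ * _)); lia.
      have {}lk : l != k :> nat by rewrite (inj_eq val_inj).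
      (* For [l < k] the exponent [N - k + l] is already between 0 and [N]; for [l > k] it is
         reduced by one period to [l - k]. *)
      rewrite mul0r; have [lt_lk|le_kl] := ltnP l k.
        by rewrite sum_expi_root //; lia.
      rewrite -[RHS](@sum_expi_root R N N0 (l - k)); last by lia.
      apply: eq_bigr => j _; have -> : (N - k + l = l - k + 1 * N)%N by lia.
      rewrite mulnDr exprD mul1n [(j * N)%N]mulnC [w ^+ (N * j)]exprM.
      by rewrite expi_root_order // expr1n mulr1.
    by field.
  have -> : \sum_(j < N) (W t j)%:C%C *: G j =
      \sum_(l < m) (\sum_(j < N) (W t j)%:C%C * w ^+ (j * l)) *: g l.
    under eq_bigr do rewrite scaler_sumr.
    rewrite exchange_big /=; apply: eq_bigr => l _; rewrite scaler_suml.
    by apply: eq_bigr => j _; rewrite scalerA.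
  under eq_bigr do rewrite coef scalerDl -scalerA.
  rewrite big_split /= (bigD1 k0) //= eqxx scale1r big1 ?addr0; last first.
    by move=> l /negPf ->; rewrite scale0r.
  rewrite (bigD1 k) //= eqxx scale1r big1 ?addr0 ?scalerA //.
  by move=> l /negPf ->; rewrite scale0r scaler0.
(* The sum of the squares of [cos t + C j] and [sin t + S j] is twice
   [1 + cos t * C j + sin t * S j]. *)
have W0 t j : 0 <= W t j.
  rewrite mulr_ge0 ?invr_ge0 //.
  have := norm_expi_root (j * k); rewrite -/(C j) -/(S j).
  have := cos2Dsin2 t; have := sqr_ge0 (cos t + C j); have := sqr_ge0 (sin t + S j).
  lra.
have W1 t : \sum_(j < N) W t j = 1.
  rewrite -mulr_sumr big_split /= sumr_const card_ord big_split /= -!mulr_sumr.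
  by rewrite sumC sumS !mulr0 !addr0 mulVf.
pose a j := nX (G j) `^ p.
have -> : lam / 2 `^ p * nX (g k) `^ p = lam * nX (2^-1 *: g k) `^ p.
  have -> : 2^-1 = ((2^-1 : R)%:C)%C by rewrite fmorphV rmorph_nat.
  rewrite nXZ Re_norm_real ger0_norm ?invr_ge0 // powRM ?nX_ge0 ?invr_ge0 //.
  by rewrite -[2^-1 in RHS]powR_inv1 // -powRrM mulN1r powRN mulrA.
apply: (@PL_ineq_trig_bound R X p lam _ _ _
  (N%:R^-1 * \sum_(j < N) C j * a j) (N%:R^-1 * \sum_(j < N) S j * a j)) => // t.
rewrite GW; apply: (@le_trans _ _ ((\sum_(j < N) W t j * nX (G j)) `^ p)).
  have Wn0 : 0 <= \sum_(j < N) W t j * nX (G j).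
    by apply: sumr_ge0 => j _; rewrite mulr_ge0 ?nX_ge0.
  apply: ge0_ler_powR; rewrite ?nnegrE ?nX_ge0 //.
  apply: le_trans (nX_sum _ _ _) _; apply: ler_sum => j _.
  by rewrite nXZ Re_norm_real ger0_norm.
apply: le_trans (powR_jensen _ _ _ _) _ => //; first by move=> j; apply: nX_ge0.
rewrite le_eqVlt; apply/orP; left; apply/eqP.
transitivity (N%:R^-1 *
    \sum_(j < N) (a j + cos t * (C j * a j) + sin t * (S j * a j))).
  by rewrite mulr_sumr; apply: eq_bigr => j _; rewrite /W /a; ring.
by rewrite !big_split /= -!mulr_sumr; rewrite /a /G; ring.
Qed.
End OneVariable.

(** * Splitting off the first coordinate of a finite multi-index *)

Section FfunCons.
Variables (T : finType) (n : nat).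

Definition fcons (x : T) (f : {ffun 'I_n -> T}) : {ffun 'I_n.+1 -> T} :=
  [ffun i => if unlift ord0 i is Some j then f j else x].

Lemma fcons0 x f : fcons x f ord0 = x.
Proof. by rewrite ffunE unlift_none. Qed.

Lemma fconsS x f i : fcons x f (lift ord0 i) = f i.
Proof. by rewrite ffunE liftK. Qed.

Lemma big_ffun_recl (V : nmodType) (F : {ffun 'I_n.+1 -> T} -> V) :
  \sum_a F a = \sum_x \sum_f F (fcons x f).
Proof.
rewrite pair_big /= (reindex (fun q => fcons q.1 q.2)) //=.
exists (fun a => (a ord0, [ffun i => a (lift ord0 i)])) => [[x f]|a] _ /=.
  by rewrite fcons0; congr pair; apply/ffunP => i; rewrite ffunE fconsS.
apply/ffunP => i; rewrite ffunE.
by case: unliftP => [j ->|->]; rewrite ?ffunE.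
Qed.

End FfunCons.

Lemma big_ffun0 (T : finType) (V : nmodType) (F : {ffun 'I_0 -> T} -> V) :
  \sum_f F f = F (ffun0 (card_ord 0)).
Proof.
by rewrite (bigD1 (ffun0 (card_ord 0))) //= big1 ?addr0 // => f /eqP[]; apply/ffunP; case.
Qed.

(** * The weighted coefficient sum and its tensorization *)

Section SeveralVariables.
Variables (R : realType) (X : completeNormedModType R[i]) (p lam s : R).
Hypothesis p1 : 1 < p.
Hypothesis lam0 : 0 < lam.
Hypothesis PL : PL_ineq X p lam.
Hypothesis s0 : 0 <= s.
Hypothesis s1 : s <= lam / 2 `^ p * (1 - s).
Variables m N : nat.
Hypothesis N0 : (0 < N)%N.
Hypothesis leq_2m_N : (m.*2 <= N)%N.
Let w : R[i] := expi ((pi *+ 2) / N%:R).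

Lemma coef_sum_bound (g : 'I_m -> X) :
  \sum_(k < m) s ^+ k * nX (g k) `^ p <=
  N%:R^-1 * \sum_(j < N) nX (\sum_(l < m) w ^+ (j * l) *: g l) `^ p.
Proof.
set M := N%:R^-1 * _; set c := lam / 2 `^ p.
have c0 : 0 < c by rewrite divr_gt0 // powR_gt0.
have NR0 : N%:R != 0 :> R by rewrite pnatr_eq0 -lt0n.
have cb (k0 k : 'I_m) := @coef_bound _ X _ _ p1 PL m N leq_2m_N g k0 k.
case: m g @M cb => [|m'] g M cb.
  by rewrite big_ord0 mulr_ge0 ?invr_ge0 // sumr_ge0 // => j _; rewrite powR_ge0.
rewrite big_ord_recl expr0 mul1r.
(* A constant polynomial has no coefficient of positive index from which to read [0 <= D], but then
   both sides agree. *)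
case: m' g @M cb => [|m'] g M cb.
  rewrite big_ord0 addr0 /M.
  under eq_bigr do rewrite big_ord1 muln0 expr0 scale1r.
  by rewrite sumr_const card_ord -[X in _ * X]mulr_natl mulKf.
have {}cb (i : 'I_m'.+1) : c * nX (g (lift ord0 i)) `^ p <= M - nX (g ord0) `^ p.
  by rewrite lerBrDl; apply: cb.
set D := M - _ in cb.
suff : \sum_(i < m'.+1) s ^+ lift ord0 i * nX (g (lift ord0 i)) `^ p <= D.
  by rewrite /D lerBrDl.
rewrite -(ler_pM2l c0) mulr_sumr.
have D0 : 0 <= D.
  by apply: le_trans (cb ord0); rewrite mulr_ge0 ?powR_ge0 // ltW.
apply: (@le_trans _ _ ((\sum_(i < m'.+1) s ^+ i.+1) * D)).
  rewrite mulr_suml; apply: ler_sum => i _.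
  by rewrite mulrCA ler_wpM2l ?exprn_ge0.
rewrite ler_wpM2r //; under eq_bigr do rewrite exprS.
rewrite -mulr_sumr; set S := \sum_(i < _) _.
have S0 : 0 <= S by apply: sumr_ge0 => i _; rewrite exprn_ge0.
apply: le_trans (ler_wpM2r S0 s1) _.
rewrite -/c -mulrA ler_piMr ?(ltW c0) //.
have -> : (1 - s) * S = 1 - s ^+ m'.+1 by rewrite -opprB mulNr -subrX1 opprB.
by rewrite gerBl exprn_ge0.
Qed.

(** Induction on [n]: the hypothesis is applied to each slice with first index [k]. After exchanging
    sums, the one-variable bound applies at each fixed torus point of the other variables. Both
    constants are 1, so nothing is lost. *)
Lemma coef_sum_bound_multi n (c : {ffun 'I_n -> 'I_m} -> X) :
  \sum_(a : {ffun 'I_n -> 'I_m}) (\prod_i s ^+ a i) * nX (c a) `^ p <=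
  N%:R^-1 ^+ n * \sum_(j : {ffun 'I_n -> 'I_N})
    nX (\sum_(a : {ffun 'I_n -> 'I_m}) (\prod_i w ^+ (j i * a i)) *: c a) `^ p.
Proof.
elim: n c => [|n IH] c.
  by rewrite !big_ffun0 !big_ord0 expr0 !mul1r scale1r.
rewrite big_ffun_recl.
apply: (@le_trans _ _ (\sum_(k < m) s ^+ k * (N%:R^-1 ^+ n *
    \sum_(j : {ffun 'I_n -> 'I_N})
      nX (\sum_(b : {ffun 'I_n -> 'I_m}) (\prod_i w ^+ (j i * b i)) *: c (fcons k b)) `^ p))).
  apply: ler_sum => k _; apply: le_trans (ler_wpM2l (exprn_ge0 k s0) (IH _)).
  rewrite mulr_sumr; apply: ler_sum => b _.
  rewrite big_ord_recl fcons0 mulrA.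
  by rewrite (eq_bigr (fun i => s ^+ b i)) // => i _; rewrite fconsS.
have -> : N%:R^-1 ^+ n.+1 * \sum_(j : {ffun 'I_n.+1 -> 'I_N})
    nX (\sum_(a : {ffun 'I_n.+1 -> 'I_m}) (\prod_i w ^+ (j i * a i)) *: c a) `^ p =
  N%:R^-1 ^+ n * \sum_(j : {ffun 'I_n -> 'I_N}) (N%:R^-1 *
    \sum_(j0 < N) nX (\sum_(k < m) w ^+ (j0 * k) *:
      \sum_(b : {ffun 'I_n -> 'I_m}) (\prod_i w ^+ (j i * b i)) *: c (fcons k b)) `^ p).
  rewrite exprSr -mulrA -mulr_sumr exchange_big /= big_ffun_recl.
  congr (_ * (_ * _)); apply: eq_bigr => j0 _; apply: eq_bigr => j _.
  rewrite big_ffun_recl; congr (nX _ `^ p); apply: eq_bigr => k _.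
  rewrite scaler_sumr; apply: eq_bigr => b _.
  rewrite big_ord_recl !fcons0 scalerA; congr (_ * _ *: _).
  by apply: eq_bigr => i _; rewrite !fconsS.
under eq_bigr do rewrite mulrCA mulr_sumr.
rewrite -mulr_sumr exchange_big /= ler_wpM2l ?exprn_ge0 ?invr_ge0 //.
by apply: ler_sum => j _; apply: coef_sum_bound.
Qed.

End SeveralVariables.

(** * Comparing sums over boxes of multi-indices *)

Section Boxes.
Variable n : nat.

Lemma mlift_inj N : injective (@mlift n N).
Proof.
move=> a b /ffunP ab; apply/ffunP => i; apply/val_inj.
by have := ab i; rewrite !ffunE.
Qed.

(** Boxes of different sizes are different finite types; viewing the small one as a filter on the
    large one makes their sums comparable. *)
Lemma big_box_widen (V : nmodType) (F : mindex n -> V) m K : (m <= K)%N ->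
  \sum_(b : {ffun 'I_n -> 'I_m.+1}) F (mlift b) =
  \sum_(b : {ffun 'I_n -> 'I_K.+1} | [forall i, (b i <= m)%N]) F (mlift b).
Proof.
move=> mK.
pose h (b : {ffun 'I_n -> 'I_m.+1}) : {ffun 'I_n -> 'I_K.+1} := [ffun i => inord (b i)].
have hE b i : h b i = b i :> nat.
  by rewrite ffunE inordK // (leq_trans (ltn_ord _)).
rewrite (reindex h) /=; last first.
  exists (fun b : {ffun 'I_n -> 'I_K.+1} => [ffun i => inord (b i)]) => b.
    by move=> _; apply/ffunP => i; apply/val_inj; rewrite ffunE /= hE inord_val.
  rewrite inE => /forallP bm; apply/ffunP => i; apply/val_inj.
  by rewrite /= hE ffunE inordK // ltnS.
apply: eq_big => [b|b _]; first by apply/esym/forallP => i; rewrite hE -ltnS.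
by congr F; apply/ffunP => i; rewrite !ffunE inordK // (leq_trans (ltn_ord _)).
Qed.

Variable R : numDomainType.

Lemma box_sum_le (F : mindex n -> R) m K : (forall a, 0 <= F a) -> (m <= K)%N ->
  \sum_(b : {ffun 'I_n -> 'I_m.+1}) F (mlift b) <=
  \sum_(b : {ffun 'I_n -> 'I_K.+1}) F (mlift b).
Proof.
move=> F0 mK; rewrite (big_box_widen F mK).
rewrite [leRHS](bigID (fun b : {ffun 'I_n -> 'I_K.+1} => [forall i, (b i <= m)%N])) /=.
by rewrite lerDl sumr_ge0.
Qed.

Lemma seq_sum_le_box (F : mindex n -> R) (r : seq (mindex n)) :
  (forall a, 0 <= F a) -> uniq r ->
  exists m, \sum_(a <- r) F a <= \sum_(b : {ffun 'I_n -> 'I_m.+1}) F (mlift b).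
Proof.
(* The sum of all entries of all indices in [r] is a crude bound for each entry, so [inord] alters
   none of them. *)
move=> F0 ur; pose m := (\sum_(a <- r) \sum_i a i)%N; exists m.
pose h (a : mindex n) : {ffun 'I_n -> 'I_m.+1} := [ffun i => inord (a i)].
have hK : {in r, cancel h (@mlift n m.+1)}.
  move=> a ar; apply/ffunP => i; rewrite !ffunE inordK // ltnS.
  by rewrite /m (big_rem a) //= (bigD1 i) //= -addnA leq_addr.
have -> : \sum_(a <- r) F a = \sum_(b <- [seq h a | a <- r]) F (mlift b).
  by rewrite big_map big_seq [RHS]big_seq; apply: eq_bigr => a ar; rewrite hK.
rewrite big_uniq /=; last first.
  by rewrite map_inj_in_uniq //; apply: (can_in_inj hK).
rewrite [leRHS](bigID (fun b => b \in [seq h a | a <- r])) /=.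
by rewrite lerDl sumr_ge0.
Qed.

End Boxes.

(** * Box sums versus extended sums over all multi-indices *)

Section EsumBoxes.
Variables (R : realType) (n : nat) (F : mindex n -> R).
Hypothesis F0 : forall a, 0 <= F a.

Lemma box_sum_le_esum m :
  ((\sum_(b : {ffun 'I_n -> 'I_m}) F (mlift b))%:E <=
   \esum_(a in [set: mindex n]) (F a)%:E)%E.
Proof.
apply: esum_ge; exists [set` [seq mlift b | b : {ffun 'I_n -> 'I_m}]]%classic.
  by split; [exact: finite_seq|].
rewrite -fsbig_seq; last by rewrite map_inj_uniq ?enum_uniq //; apply: mlift_inj.
by rewrite sumEFin big_map big_enum.
Qed.

(** Adjoining the zero index to a finite set of nonzero ones gives a duplicate-free list, which fits
    in some box. *)
Lemma esum_nonzero_le (B : R) :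
  (forall m, \sum_(b : {ffun 'I_n -> 'I_m.+1}) F (mlift b) <= B) ->
  ((F (Defs.mzero n))%:E + \esum_(a in [set a | a != Defs.mzero n]%classic) (F a)%:E <= B%:E)%E.
Proof.
move=> FB.
suff H : (\esum_(a in [set a | a != Defs.mzero n]%classic) (F a)%:E <= (B - F (Defs.mzero n))%:E)%E.
  by apply: le_trans (leeD2l _ H) _; rewrite -EFinD subrKC.
apply: ub_ereal_sup => _ [Y [finY sY] <-].
rewrite fsbig_finite //= sumEFin lee_fin lerBrDl.
have ur : uniq (Defs.mzero n :: finmap.enum_fset (fset_set Y)).
  rewrite /= finmap.fset_uniq andbT; apply/negP => /=.
  by rewrite in_fset_set // inE => /sY /=; rewrite eqxx.
have [m Hm] := seq_sum_le_box F0 ur.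
by rewrite big_cons in Hm; apply: le_trans Hm (FB m).
Qed.

End EsumBoxes.

(** * From bounded holomorphic functions to their polynomial truncations *)

Section BoundedHolomorphic.
Variables (R : realType) (X : completeNormedModType R[i]) (n : nat).
Variable c : mindex n -> X.
Hypothesis cb : bounded_holo_coef c.

Let psum m (z : 'I_n -> R[i]) : X :=
  \sum_(b : {ffun 'I_n -> 'I_m.+1}) zmono z (mlift b) *: c (mlift b).

Lemma norm_zmono (z : 'I_n -> R[i]) a :
  complex.Re `|zmono z a| = \prod_i complex.Re `|z i| ^+ a i.
Proof. by rewrite Re_norm_prod; apply: eq_bigr => i _; rewrite Re_normX. Qed.

(** Absolute convergence at the single point [(rho, ..., rho)] dominates the tails at every [z] of
    the closed polydisk of radius [rho], hence one [m] for all [z]. *)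
Lemma partial_sum_bound (rho : R) m0 (d : R) : 0 <= rho < 1 -> 0 < d ->
  exists2 m, (m0 <= m)%N &
    forall z, (forall i, complex.Re `|z i| <= rho) -> nX (psum m z) <= 1 + d.
Proof.
move=> /andP[rho0 rho1] d0; have [cs cf] := cb.
pose zr (i : 'I_n) : R[i] := rho%:C%C.
pose A (a : mindex n) := nX (zmono zr a *: c a).
have A0 a : 0 <= A a by apply: nX_ge0.
pose S m := \sum_(b : {ffun 'I_n -> 'I_m.+1}) A (mlift b).
have hs : has_sup (range S).
  split; first by exists (S 0%N), 0%N.
  have /cs H : in_polydisk 1 zr by move=> i; rewrite Re_norm_real ger0_norm.
  have fin : (\esum_(a in [set: mindex n]) (A a)%:E)%E \is a fin_num.
    by rewrite ge0_fin_numE //; apply: esum_ge0 => a _; rewrite lee_fin.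
  exists (fine (\esum_(a in [set: mindex n]) (A a)%:E)%E) => _ [m _ <-].
  by rewrite -lee_fin fineK //; apply: box_sum_le_esum.
have [_ [m1 _ <-] Sm1] := sup_adherent d0 hs.
pose m := maxn m0 m1; exists m; first exact: leq_maxl.
move=> z zrho; have /cf [fz cvg_fz fz1] : in_polydisk 1 z.
  by move=> i; apply: le_lt_trans rho1.
apply/ler_addgt0Pr => e e0.
have : 0 < e%:C%C :> R[i] by rewrite ltcR.
move/cvgrPdist_lt : cvg_fz => /[apply] -[N1 _ HN].
(* [N1] depends on [z] and [e], while [m] does not: [psum K z] is close to [fz], and the gap down to
   [psum m z] is at most [d]. *)
pose K := maxn N1 m.
have := HN K.+1; rewrite /= => /(_ _) fK; have {fK} fK : `|fz - psum K z| < e%:C%C.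
  by apply: fK; rewrite /= (leq_trans (leq_maxl N1 m)).
have {}fK : nX (fz - psum K z) < e by rewrite -ltcR nXE.
have mK : (m <= K)%N by apply: leq_maxr.
have SK : S K - S m <= d.
  rewrite lerBlDr; have : S K <= sup (range S) by apply: (sup_ubound hs.2); exists K.
  have : S m1 <= S m by apply: box_sum_le => //; apply: leq_maxr.
  by move: Sm1; lra.
have tail : nX (psum K z - psum m z) <= S K - S m.
  rewrite /psum /S (big_box_widen (fun a => zmono z a *: c a) mK) (big_box_widen A mK).
  rewrite (bigID (fun b : {ffun 'I_n -> 'I_K.+1} => [forall i, (b i <= m)%N])) /= addrC addrK.
  rewrite [X in X - _](bigID (fun b : {ffun 'I_n -> 'I_K.+1} => [forall i, (b i <= m)%N])) /=.
  rewrite [X in X - _]addrC addrK.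
  apply: le_trans (nX_sum _ _ _) _; apply: ler_sum => b _.
  rewrite /A !nXZ ler_wpM2r ?nX_ge0 // !norm_zmono.
  apply: ler_prod => i _; apply/andP; split; first by rewrite exprn_ge0 ?Re_norm_ge0.
  by rewrite lerXn2r ?nnegrE ?Re_norm_ge0 // Re_norm_real (ger0_norm rho0) zrho.
have -> : psum m z = fz - (fz - psum K z) - (psum K z - psum m z).
  by rewrite !opprB !subrKC.
apply: le_trans (nX_triangle _ _) _; rewrite nXN.
have := nX_triangle fz (- (fz - psum K z)); rewrite nXN.
by move: tail SK fK fz1; lra.
Qed.

Variables (p lam s : R).
Hypothesis p1 : 1 < p.
Hypothesis lam0 : 0 < lam.
Hypothesis PL : PL_ineq X p lam.
Hypothesis s0 : 0 <= s.
Hypothesis s1 : s <= lam / 2 `^ p * (1 - s).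

Lemma weighted_box_sum_le1 (rho : R) m : 0 <= rho < 1 ->
  \sum_(b : {ffun 'I_n -> 'I_m.+1})
     (\prod_i s ^+ mlift b i) * nX (zmono (fun=> rho%:C%C) (mlift b) *: c (mlift b)) `^ p <= 1.
Proof.
move=> rho01.
have p0 : 0 < p by apply: lt_trans p1.
pose zr (i : 'I_n) : R[i] := rho%:C%C.
pose F (a : mindex n) := (\prod_i s ^+ a i) * nX (zmono zr a *: c a) `^ p.
rewrite -/zr; set Y := leLHS.
have F0 a : 0 <= F a.
  by rewrite mulr_ge0 ?powR_ge0 // prodr_ge0 // => i _; rewrite exprn_ge0.
have Y0 : 0 <= Y by apply: sumr_ge0 => b _; apply: F0.
have Yd d : 0 < d -> Y <= (1 + d) `^ p.
  move=> d0; have [M mM H] := partial_sum_bound m rho01 d0.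
  apply: (le_trans (box_sum_le F0 mM)).
  pose N := M.+1.*2; have N0 : (0 < N)%N by rewrite double_gt0.
  pose g (b : {ffun 'I_n -> 'I_M.+1}) := zmono zr (mlift b) *: c (mlift b).
  have := coef_sum_bound_multi p1 lam0 PL s0 s1 N0 (leqnn N) g.
  set w := expi _ => G.
  apply: le_trans (le_trans _ G) _.
    by apply: ler_sum => b _; rewrite le_eqVlt; apply/orP; left; apply/eqP;
       congr (_ * _); apply: eq_bigr => i _; rewrite ffunE.
  have wb (j : {ffun 'I_n -> 'I_N}) :
      nX (\sum_(b : {ffun 'I_n -> 'I_M.+1}) (\prod_i w ^+ (j i * b i)) *: g b) `^ p
        <= (1 + d) `^ p.
    have d1 : 0 <= 1 + d by lra.
    apply: ge0_ler_powR; rewrite ?nnegrE ?nX_ge0 ?(ltW p0) //.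
    apply: le_trans (H (fun i => rho%:C%C * w ^+ j i) _).
      rewrite le_eqVlt; apply/orP; left; apply/eqP; congr nX.
      apply: eq_bigr => b _; rewrite scalerA; congr (_ *: _).
      rewrite /zmono -big_split /=; apply: eq_bigr => i _.
      by rewrite !ffunE exprMn mulrC exprM.
    move=> i; rewrite Re_normM Re_normX norm_expi expr1n mulr1 Re_norm_real.
    by case/andP: rho01 => r0 _; rewrite ger0_norm.
  apply: (@le_trans _ _ (N%:R^-1 ^+ n * \sum_(j : {ffun 'I_n -> 'I_N}) (1 + d) `^ p)).
    by rewrite ler_wpM2l ?exprn_ge0 ?invr_ge0 //; apply: ler_sum.
  rewrite sumr_const card_ffun !card_ord -[_ *+ (N ^ n)]mulr_natl natrX exprVn.
  by rewrite mulKf // expf_neq0 // pnatr_eq0 -lt0n.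
(* Taking [p]-th roots first makes the bound [1 + d], so the limit needs no continuity of the
   power. *)
have : Y `^ p^-1 <= 1.
  apply/ler_addgt0Pr => d d0.
  have d1 : 0 <= 1 + d by lra.
  rewrite -[leRHS]powRr1 // -[X in _ <= _ `^ X](mulfV (lt0r_neq0 p0)) powRrM.
  by apply: ge0_ler_powR; rewrite ?nnegrE ?powR_ge0 ?invr_ge0 ?(ltW p0) ?Yd.
move=> H; rewrite -[Y]powRr1 // -[X in _ `^ X <= _](mulVf (lt0r_neq0 p0)) powRrM.
apply: (@le_trans _ _ (1 `^ p)); last by rewrite powR1.
by apply: ge0_ler_powR; rewrite ?nnegrE ?powR_ge0 ?(ltW p0).
Qed.

End BoundedHolomorphic.

(** * The constant [I_p] and the two bounds on the radius *)

Section Radius.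
Variables (R : realType) (X : completeNormedModType R[i]) (p : R).

Lemma dim_ge2_unit : dim_ge2 X -> exists u : X, nX u = 1.
Proof.
move=> [x [y xy]].
have x0 : x != 0.
  apply/eqP => x0; have [/eqP] : (1 : R[i]) = 0 /\ (0 : R[i]) = 0.
    by apply: xy; rewrite x0 scaler0 scale0r addr0.
  by rewrite oner_eq0.
have nx : nX x != 0.
  apply: contra x0 => /eqP nx; have := nXE x; rewrite nx => /esym/eqP.
  by rewrite normr_eq0.
exists ((nX x)^-1%:C%C *: x).
by rewrite nXZ Re_norm_real ger0_norm ?invr_ge0 ?nX_ge0 // mulVf.
Qed.

(** Take [x = 0] and [y = u], where the integrand is constantly 1. The admissible constants are thus
    bounded above, so the real [sup] in [I_p] is a genuine supremum. *)
Lemma PL_ineq_le1 lam (u : X) : 0 < p -> PL_ineq X p lam -> nX u = 1 -> lam <= 1.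
Proof.
move=> p0 PL u1.
have := @PL_ineq_trig_bound R X p lam 0 u 1 0 0 PL.
rewrite nX0 u1 powR1 mulr1 powR0 ?gt_eqF // add0r; apply => t.
by rewrite add0r nXZ norm_expi u1 mul1r powR1 !mul0r !addr0.
Qed.

Lemma I_p_gt0 : 0 < p -> PL_convex X p -> dim_ge2 X -> 0 < I_p X p.
Proof.
move=> p0 [lam lam0 PL] /dim_ge2_unit[u u1].
apply: (lt_le_trans lam0); apply: sup_ubound; last by split.
by exists 1 => l [_ PLl]; apply: PL_ineq_le1 PLl u1.
Qed.

Lemma PL_ineq_I_p : 0 < p -> PL_convex X p -> PL_ineq X p (I_p X p).
Proof.
move=> p0 [lam lam0 PL] x y.
pose S : set R := [set l : R | 0 < l /\ PL_ineq X p l]%classic.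
have HS l : S l -> PL_ineq X p l by case.
have Slam : S lam by [].
have : forall l, S l -> _ := fun l Sl => HS l Sl x y; set J := (_ * _)%E.
case: J => [j| |] HJ; last 2 first.
- by rewrite leey.
- by have := HJ _ Slam.
have [y0|y0] := eqVneq (nX y) 0.
  by have := HJ _ Slam; rewrite !lee_fin y0 powR0 ?gt_eqF // !mulr0.
have Y0 : 0 < nX y `^ p by rewrite powR_gt0 // lt_neqAle eq_sym y0 nX_ge0.
rewrite lee_fin -lerBrDl -ler_pdivlMr //; apply: ge_sup; first by exists lam.
by move=> l /HJ; rewrite lee_fin ler_pdivlMr // lerBrDl.
Qed.

Lemma p_sum_le1 n (c : mindex n -> X) (lam r : R) z :
  1 < p -> 0 < lam -> PL_ineq X p lam -> 0 < r ->
  r `^ p <= lam / 2 `^ p * (1 - r `^ p) ->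
  bounded_holo_coef c -> in_polydisk r z -> (p_sum p c z <= 1%:E)%E.
Proof.
move=> p1 lam0 PL r0 rle cb zr.
have p0 : 0 <= p by apply: ltW (lt_trans ltr01 p1).
have [rho rho01 zrho] : exists2 rho : R, 0 <= rho < 1 &
    forall i, complex.Re `|z i| <= rho * r.
  (* Strictly below 1, being a maximum of finitely many ratios below 1 and the default 0. *)
  exists (\big[Num.max/0]_i (complex.Re `|z i| / r)).
    apply/andP; split.
      by elim/big_rec: _ => // i x _ x0; rewrite le_max x0 orbT.
    elim/big_rec: _ => // i x _ x1; rewrite gt_max x1 andbT.
    by rewrite ltr_pdivrMr // mul1r.
  by move=> i; rewrite -ler_pdivrMr //; apply: le_bigmax.
pose F a := nX (zmono z a *: c a) `^ p.
have z0 : zmono z (Defs.mzero n) = 1.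
  by rewrite /zmono big1 // => i _; rewrite ffunE expr0.
have -> : p_sum p c z = ((F (Defs.mzero n))%:E +
    \esum_(a in [set a : mindex n | a != Defs.mzero n]%classic) (F a)%:E)%E.
  by rewrite /p_sum /F z0 scale1r.
apply: esum_nonzero_le => [a|m]; first exact: powR_ge0.
have := weighted_box_sum_le1 cb p1 lam0 PL (powR_ge0 r p) rle m rho01.
apply: le_trans; apply: ler_sum => b _; rewrite /F; set a := mlift b.
have [rho0 _] := andP rho01.
have -> : \prod_i (r `^ p) ^+ a i = (\prod_i r ^+ a i) `^ p.
  rewrite !prodrXr; set k := (\sum_i _)%N.
  by rewrite -powR_mulrn ?powR_ge0 // -powRrM mulrC powRrM powR_mulrn // ltW.
have P0 : 0 <= \prod_i r ^+ a i.
  by apply: prodr_ge0 => i _; rewrite exprn_ge0 // ltW.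
rewrite -powRM ?nX_ge0 //.
apply: ge0_ler_powR; rewrite ?nnegrE ?mulr_ge0 ?nX_ge0 //.
rewrite !nXZ mulrA ler_wpM2r ?nX_ge0 // !norm_zmono.
apply: (@le_trans _ _ (\prod_i (rho * r) ^+ a i)).
  apply: ler_prod => i _; rewrite exprn_ge0 ?Re_norm_ge0 // andTb.
  by rewrite lerXn2r ?nnegrE ?Re_norm_ge0 // mulr_ge0 // ltW.
rewrite le_eqVlt; apply/orP; left; apply/eqP.
under eq_bigr do rewrite exprMn mulrC.
rewrite big_split; congr (_ * _).
by apply: eq_bigr => i _; rewrite Re_norm_real (ger0_norm rho0).
Qed.

Lemma r_pn_ge n (lam r : R) :
  1 < p -> 0 < lam -> PL_ineq X p lam -> 0 < r ->
  r `^ p <= lam / 2 `^ p * (1 - r `^ p) -> (r%:E <= r_pn X p n)%E.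
Proof.
move=> p1 lam0 PL r0 rle; apply: le_ereal_inf_tmp => _ [c cb <-].
apply: ereal_sup_ubound; exists r => //; split; first exact: ltW.
by move=> z zr; apply: p_sum_le1 rle cb zr.
Qed.

(** * The extremal linear function *)

Section UpperBound.
Variables (n : nat) (i0 : 'I_n) (u : X).
Hypothesis u1 : nX u = 1.
Let d : mindex n := [ffun i => (i == i0) : nat].
Let c (a : mindex n) : X := if a == d then u else 0.

Let zmono_d z : zmono z d = z i0 :> R[i].
Proof.
rewrite /zmono (bigD1 i0) //= ffunE eqxx big1 ?mulr1 // => i /negPf ni.
by rewrite ffunE ni.
Qed.

(** Stated for a general [f] to serve both for the norm, in absolute convergence, and for its [p]-th
    power, in [p_sum]. *)
Let esum_c (f : X -> R) (A : set (mindex n)) z : f 0 = 0 -> (forall x, 0 <= f x) ->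
  A d -> (\esum_(a in A) (f (zmono z a *: c a))%:E = (f (z i0 *: u))%:E)%E.
Proof.
move=> f0 fge0 Ad; rewrite -zmono_d.
have -> : (f (zmono z d *: u))%:E = \esum_(a in [set d]%classic) (f (zmono z a *: c a))%:E.
  by rewrite esum_set1 ?lee_fin // /c eqxx.
rewrite esum_mkcond [RHS]esum_mkcond; apply: eq_esum => a _.
rewrite /c; have [->|ad] := eqVneq a d; first by rewrite !mem_set.
by rewrite scaler0 f0 !if_same.
Qed.

Lemma bounded_holo_linear : bounded_holo_coef c.
Proof.
split=> z z1.
  by rewrite (esum_c z (nX0 X) (@nX_ge0 _ X)) // ltry.
exists (z i0 *: u); last first.
  by rewrite nXZ u1 mulr1 ltW.
(* The box of size 1 contains only the zero index; from size 2 on, the box contains [d] and the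
   partial sums are stationary. *)
apply: cvg_near_cst; exists 2%N => // N /= N2.
have N0 : (1 < N)%N by [].
pose b0 : {ffun 'I_n -> 'I_N} :=
  [ffun i => if i == i0 then Ordinal N0 else Ordinal (ltnW N0)].
have b0d : mlift b0 = d by apply/ffunP => i; rewrite !ffunE; case: eqP.
rewrite (bigD1 b0) //= b0d zmono_d /c eqxx big1 ?addr0 // => b bb0.
case: eqP => [bd|]; last by rewrite scaler0.
by move/eqP: bb0; case; apply: (@mlift_inj n N); rewrite b0d.
Qed.

Lemma r_pn_le1 : 0 < p -> (r_pn X p n <= 1%:E)%E.
Proof.
move=> p0; apply: (@le_trans _ _ (r_pf p c)).
  by apply: ereal_inf_lbound; exists c => //; apply: bounded_holo_linear.
apply: ub_ereal_sup => _ [r [r0 H] <-]; rewrite lee_fin leNgt; apply/negP => r1.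
pose t : R := (1 + r) / 2.
have t1 : 1 < t by rewrite /t; lra.
have t0 : 0 <= t by lra.
have /H : in_polydisk r (fun i : 'I_n => t%:C%C).
  by move=> i; rewrite Re_norm_real ger0_norm // /t; lra.
rewrite /p_sum (esum_c _ (f := fun x => nX x `^ p)).
- rewrite -EFinD lee_fin nXZ u1 mulr1 Re_norm_real ger0_norm // leNgt.
  apply/negP/negPn; apply: (@lt_le_trans _ _ (t `^ p)); last first.
    by rewrite lerDr powR_ge0.
  apply: (@le_lt_trans _ _ (1 `^ p)); first by rewrite powR1.
  by apply: gt0_ltr_powR; rewrite ?nnegrE.
- by rewrite nX0 powR0 // gt_eqF.
- by move=> x; apply: powR_ge0.
- by apply/eqP => /ffunP /(_ i0); rewrite !ffunE eqxx.
Qed.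

End UpperBound.
End Radius.

Theorem theorem1p4 (R : realType) (X : completeNormedModType R[i]) (p : R) :
  2 <= p -> PL_convex X p -> dim_ge2 X ->
  forall n : nat, (0 < n)%N ->
    (((I_p X p / (2 `^ p + I_p X p)) `^ (2 / p))%:E <= r_pn X p n)%E /\
    (r_pn X p n <= 1%:E)%E.
Proof.
move=> p2 PL dX n n0.
have p0 : 0 < p by lra.
have p1 : 1 < p by lra.
split; last first.
  have [u u1] := dim_ge2_unit dX.
  exact: (r_pn_le1 (Ordinal n0) u1 p0).
have I0 := I_p_gt0 p0 PL dX; set I := I_p X p in I0 *.
have D0 : 0 < 2 `^ p :> R by rewrite powR_gt0.
have t0 : 0 < I / (2 `^ p + I) by rewrite divr_gt0 // addr_gt0.
apply: (r_pn_ge n p1 I0 (PL_ineq_I_p p0 PL)); first exact: powR_gt0.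
rewrite -powRrM divfK ?gt_eqF // powR_mulrn ?(ltW t0) //.
(* The [p]-th power of the claimed radius is [t ^+ 2], while [t] itself solves the condition on [s]
   with equality. Since [t <= 1], the smaller value [t ^+ 2] satisfies it too. *)
set t := I / (2 `^ p + I) in t0 *.
have It : I / 2 `^ p * (1 - t) = t.
  by rewrite /t; field; rewrite !gt_eqF // addr_gt0.
have t1 : t <= 1.
  by rewrite /t ler_pdivrMr ?addr_gt0 // mul1r lerDr ltW.
have tt : t ^+ 2 <= t by rewrite expr2 ler_piMr // ltW.
apply: (le_trans tt); rewrite -[leLHS]It ler_wpM2l //.
  by rewrite divr_ge0 // ltW.
by rewrite lerB.
Qed.
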